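(* For any $1\le p\le\infty$, $k\ge0$, and pmm-spaces $X,Y,Z$, \[ \mathsf{mPGW}^k_p(X,Z)\le\mathsf{mPGW}^k_p(X,Y)+\mathsf{mPGW}^k_p(Y,Z). \]
   Context: A pmm-space is a triple $(X,d_X,\mu_X)$ with $(X,d_X)$ a complete separable metric space and $\mu_X$ a Borel probability measure. For a nonnegative Borel measure $\pi$ on $X\times Y$, $\pi_X,\pi_Y$ are its marginals, $|\pi|$ its total mass, and for $p<\infty$, $\|d_X-d_Y\|_{L^p(\pi\otimes\pi)}=\left(\iint|d_X(x,x')-d_Y(y,y')|^p\,d\pi(x,y)\,d\pi(x',y')\right)^{1/p}$; for $p=\infty$ the $\pi\otimes\pi$-essential supremum. For $0\le\delta\le1$: $\mathsf{mPGW}_{\delta,p}(X,Y)=\inf\{\|d_X-d_Y\|_{L^p(\tilde\pi\otimes\tilde\pi)}:\tilde\pi$ nonnegative Borel measure on $X\times Y$, $\tilde\pi_X\le\mu_X$, $\tilde\pi_Y\le\mu_Y$ setwise, $|\tilde\pi|=\delta\}$. For $k\ge0$: $\mathsf{mPGW}^k_p(X,Y)=\inf\{\delta\in[0,1]:\mathsf{mPGW}_{1-\delta,p}(X,Y)\le k\delta\}$. *)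

(* Defs.v *)
From HB Require Import structures.
From mathcomp Require Import all_boot all_order all_algebra.
From mathcomp Require Import all_classical all_reals all_analysis.
Set Implicit Arguments. Unset Strict Implicit. Unset Printing Implicit Defensive.
Import Order.TTheory GRing.Theory Num.Theory.
Local Open Scope classical_set_scope.
Local Open Scope ring_scope.

Section metric.
Context {R : realType} {T : Type}.

Definition is_metric (d : T -> T -> R) : Prop :=
  [/\ (forall x y, 0 <= d x y),
      (forall x y, d x y = 0 <-> x = y),
      (forall x y, d x y = d y x) &
      (forall x y z, d x z <= d x y + d y z)].

Definition dball (d : T -> T -> R) (x : T) (r : R) : set T := [set y | d x y < r].

Definition dopen (d : T -> T -> R) : set (set T) :=
  [set A | forall x, A x -> exists2 r : R, 0 < r & dball d x r `<=` A].

Definition dcauchy (d : T -> T -> R) (u : nat -> T) : Prop :=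
  forall e : R, 0 < e -> exists N : nat, forall m n, (N <= m)%N -> (N <= n)%N -> d (u m) (u n) < e.

Definition dconverges (d : T -> T -> R) (u : nat -> T) (l : T) : Prop :=
  forall e : R, 0 < e -> exists N : nat, forall n, (N <= n)%N -> d (u n) l < e.

Definition dcomplete (d : T -> T -> R) : Prop :=
  forall u, dcauchy d u -> exists l, dconverges d u l.

Definition dseparable (d : T -> T -> R) : Prop :=
  exists D : set T, countable D /\
    forall x (e : R), 0 < e -> exists2 y, D y & d x y < e.

Definition polish_metric (d : T -> T -> R) : Prop :=
  [/\ is_metric d, dcomplete d & dseparable d].

End metric.

Definition borel_of {R : realType} {T : pointedType} (d : T -> T -> R) :=
  g_sigma_algebraType (dopen d).

Section mpgw.
Context {R : realType} {TX TY : pointedType}.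
Variables (dX : TX -> TX -> R) (dY : TY -> TY -> R).
Variables (muX : {measure set (borel_of dX) -> \bar R})
          (muY : {measure set (borel_of dY) -> \bar R}).
Local Open Scope ereal_scope.

(** nonnegative Borel measures on X x Y (finite, as their mass is delta <= 1) *)
Notation pmeas := {finite_measure set (borel_of dX * borel_of dY)%type -> \bar R}.

Definition partial_coupling (delta : R) (pi : pmeas) : Prop :=
  [/\ (forall A : set (borel_of dX), measurable A -> pi (A `*` setT) <= muX A),
      (forall B : set (borel_of dY), measurable B -> pi (setT `*` B) <= muY B) &
      pi setT = delta%:E].

Definition dist_gap (z : ((borel_of dX * borel_of dY) * (borel_of dX * borel_of dY))%type) : \bar R :=
  (dX z.1.1 z.2.1 - dY z.1.2 z.2.2)%R%:E.

Definition dis_norm (p : \bar R) (pi : pmeas) : \bar R :=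
  'N[pi \x pi]_p [dist_gap].

Definition mPGW (delta : R) (p : \bar R) : \bar R :=
  ereal_inf [set dis_norm p pi | pi in partial_coupling delta].

Definition mPGWk (k : R) (p : \bar R) : \bar R :=
  ereal_inf [set delta%:E | delta in
    [set delta : R | (0 <= delta <= 1)%R /\ mPGW (1 - delta) p <= (k * delta)%:E]].

End mpgw.

(* Main.v *)
(** The infimum defining mPGW need not be attained, so it is enough to combine
almost optimal partial couplings of (X, Y) and (Y, Z), and exact gluing along Y
can be replaced by an approximate one that needs no disintegration.  Cut Y into
countably many Borel cells A_n of small diameter, put a_n = pi12(X x A_n) and
b_n = pi23(A_n x Z), and take on (X x Y) x (Y x Z) the measure
[sum_n (pi12|X x A_n) (x) (pi23|A_n x Z) / max(a_n, b_n)].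
Its two projections are dominated by pi12 and pi23, and its mass is
[sum_n min(a_n, b_n) >= sum_n (a_n + b_n - muY(A_n)) >= 1 - s - t]; rescale it
to have mass exactly 1 - s - t.  The two Y-coordinates are almost surely close, so Minkowski's
inequality bounds the (X, Z)-distortion up to epsilon. *)
Require Import Defs.
From HB Require Import structures.
From mathcomp Require Import all_boot all_order all_algebra.
From mathcomp Require Import all_classical all_reals all_analysis.
From mathcomp Require Import measurable_realfun ess_sup_inf.
From mathcomp Require Import ring lra.
Set Implicit Arguments. Unset Strict Implicit. Unset Printing Implicit Defensive.
Import Order.TTheory GRing.Theory Num.Theory.
Local Open Scope classical_set_scope.
Local Open Scope ring_scope.
Local Open Scope ereal_scope.

(** * L^p norms under a change of measure, for finite p and p = +oo *)

Section Lnorm_change_of_measure.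
Context d1 d2 (T1 : measurableType d1) (T2 : measurableType d2) (R : realType).
Implicit Types (p : \bar R).

Let measurable_abse_powere (d : measure_display) (T : measurableType d)
    (f : T -> \bar R) (r : R) :
  measurable_fun setT f -> measurable_fun setT (fun x => `|f x| `^ r).
Proof.
move=> mf; apply: (@measurableT_comp _ _ _ _ _ _ (fun x : \bar R => x `^ r)).
  exact: measurable_poweR.
exact: measurableT_comp.
Qed.

(** Change of variables for finite [p]; for [p = +oo] the superlevel sets of the two functions have
    equal mass. The relation between [nu] and [mu] is asked on measurable sets only, since the
    square of a pushforward is compared with [mu \x mu] only there. *)
Lemma Lnorm_pushforward (mu : {measure set T1 -> \bar R})
    (nu : {measure set T2 -> \bar R}) (phi : T1 -> T2) (f : T2 -> \bar R) p :
  measurable_fun setT phi -> measurable_fun setT f -> 1 <= p ->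
  (forall A, measurable A -> nu A = mu (phi @^-1` A)) ->
  'N[nu]_p[f] = 'N[mu]_p[f \o phi].
Proof.
move=> mphi mf p1 numu; have nuT : nu setT = mu setT by rewrite numu.
rewrite unlock; case: p p1 => [r|_|//] /=.
- move=> r1; congr (_ `^ _).
  have mg := measurable_abse_powere r mf.
  transitivity (\int[pushforward mu phi]_x (`|f x| `^ r)).
    apply: eq_measure_integral => A mA _; exact: numu.
  by rewrite ge0_integral_pushforward// => y _; exact: poweR_ge0.
- rewrite nuT; case: ifPn => // _.
  have mf' : measurable_fun setT (f \o phi) by exact: measurableT_comp.
  rewrite !ess_supEmu0; [|exact: measurableT_comp..].
  have numuE y : nu ((abse \o f) @^-1` `]y, +oo[) =
      mu ((abse \o (f \o phi)) @^-1` `]y, +oo[).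
    rewrite numu// -[_ @^-1` _]setTI.
    by apply: (measurableT_comp _ mf) => //; exact: emeasurable_itv.
  by congr ereal_inf; apply/seteqP; split => y /=; rewrite numuE.
Qed.

Lemma le_Lnorm_measure (mu nu : {measure set T1 -> \bar R}) (f : T1 -> \bar R) p :
  measurable_fun setT f -> 1 <= p ->
  (forall A, measurable A -> mu A <= nu A) -> 'N[mu]_p[f] <= 'N[nu]_p[f].
Proof.
move=> mf p1 munu; rewrite unlock; case: p p1 => [r|_|//] /=.
- rewrite lee_fin => r1; apply: gt0_ler_poweR.
  + by rewrite invr_ge0 (le_trans _ r1).
  + by rewrite in_itv/= leey andbT integral_ge0// => x _; exact: poweR_ge0.
  + by rewrite in_itv/= leey andbT integral_ge0// => x _; exact: poweR_ge0.
  + apply: ge0_le_measure_integral => //; last exact: measurable_abse_powere.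
    by move=> x; exact: poweR_ge0.
(* At [p = +oo] the norm is 0 by convention on a measure of zero mass, hence the cases; otherwise a
   [nu]-null exceptional set is also [mu]-null. *)
- case: ifPn => [mu0|_].
    rewrite (lt_le_trans mu0 (munu _ _))//; apply/ess_supP.
    have [N [mN nuN subN]] := ess_sup_ge nu (abse \o f).
    exists N; split => //; apply/eqP; rewrite eq_le measure_ge0 andbT -nuN.
    exact: munu.
  case: ifPn => [nu0|//]; apply: ess_sup_gee => //; apply: nearW => x; exact: abse_ge0.
Qed.

Lemma Lnorm_le_cst (mu : {measure set T1 -> \bar R}) (f : T1 -> \bar R) p (c : R) :
  measurable_fun setT f -> 1 <= p -> mu setT <= 1 -> (0 <= c)%R ->
  {ae mu, forall x, `|f x| <= c%:E} -> 'N[mu]_p[f] <= c%:E.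
Proof.
move=> mf p1 muT c0 fc; rewrite unlock; case: p p1 => [r|_|//] /=.
- rewrite lee_fin => r1; have r0 : (0 < r)%R by rewrite (lt_le_trans _ r1).
  have -> : c%:E = ((c `^ r)%:E `^ r^-1).
    by rewrite poweR_EFin -powRrM mulfV ?gt_eqF// powRr1.
  apply: gt0_ler_poweR.
  + by rewrite invr_ge0 ltW.
  + by rewrite in_itv/= leey andbT integral_ge0// => x _; exact: poweR_ge0.
  + by rewrite in_itv/= leey andbT lee_fin powR_ge0.
  apply: (@le_trans _ _ (\int[mu]_x (cst (c `^ r)%:E x))).
    apply: ae_ge0_le_integral => //=.
    + by move=> x _; exact: poweR_ge0.
    + exact: measurable_abse_powere.
    + by move=> x _; rewrite lee_fin powR_ge0.
    apply: filterS fc => x fxc _; rewrite -poweR_EFin; apply: gt0_ler_poweR => //.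
    * exact: ltW.
    * by rewrite in_itv/= leey andbT.
    * by rewrite in_itv/= leey andbT lee_fin.
  rewrite integral_cst//= -[leRHS]mule1; apply: lee_wpmul2l => //.
  by rewrite lee_fin powR_ge0.
- by case: ifPn => [_|_]; [exact/ess_supP|rewrite lee_fin].
Qed.

End Lnorm_change_of_measure.

(** * Pushforwards of finite measures and their product squares *)

Section finite_pushforward.
Context d1 d2 (T1 : measurableType d1) (T2 : measurableType d2) (R : realType).
Variables (mu : {finite_measure set T1 -> \bar R}) (phi : T1 -> T2).
Hypothesis mphi : measurable_fun setT phi.

(** The unused proof argument lets the finite measure instance be inferred. *)
Definition finite_pushforward of measurable_fun setT phi := pushforward mu phi.

Local Notation nu := (finite_pushforward mphi).

Let nu0 : nu set0 = 0.
Proof. by rewrite /finite_pushforward /pushforward preimage_set0 measure0. Qed.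

Let nu_ge0 A : 0 <= nu A. Proof. exact: measure_ge0. Qed.

Let nu_sigma_additive : semi_sigma_additive nu.
Proof.
move=> F mF tF mUF; rewrite /finite_pushforward /pushforward preimage_bigcup.
apply: measure_semi_sigma_additive.
- by move=> n; rewrite -[X in measurable X]setTI; exact: mphi.
- apply/trivIsetP => /= i j _ _ ij; rewrite -preimage_setI.
  by move/trivIsetP : tF => /(_ _ _ _ _ ij) ->//; rewrite preimage_set0.
- by rewrite -preimage_bigcup -[X in measurable X]setTI; exact: mphi.
Qed.

HB.instance Definition _ := isMeasure.Build _ _ _ nu nu0 nu_ge0 nu_sigma_additive.

Let nu_fin : fin_num_fun nu.
Proof.
move=> A mA; apply: fin_num_measure.
by rewrite -[_ @^-1` _]setTI; exact: mphi.
Qed.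

HB.instance Definition _ := Measure_isFinite.Build _ _ _ nu nu_fin.

End finite_pushforward.

Section product_pushforward.
Context d1 d2 (T1 : measurableType d1) (T2 : measurableType d2) (R : realType).

Lemma measurable_map_pair (phi : T1 -> T2) : measurable_fun setT phi ->
  measurable_fun setT (fun z : T1 * T1 => (phi z.1, phi z.2)).
Proof. by move=> mphi; apply: measurable_fun_pair; exact: measurableT_comp. Qed.

(** The product measure integrates the mass of sections, and a section of the preimage is the
    preimage of a section; the outer integral changes variables. *)
Lemma product_pushforward (mu : {finite_measure set T1 -> \bar R})
    (phi : T1 -> T2) (mphi : measurable_fun setT phi) (A : set (T2 * T2)) :
  measurable A ->
  (finite_pushforward mu mphi \x finite_pushforward mu mphi) A =
  (mu \x mu) ((fun z => (phi z.1, phi z.2)) @^-1` A).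
Proof.
move=> mA; rewrite /product_measure1.
rewrite (@ge0_integral_pushforward _ _ _ _ _ _ mphi mu setT)//.
exact: measurable_fun_xsection.
Qed.

Lemma le_product_measure (mu nu : {finite_measure set T1 -> \bar R}) A :
  (forall A, measurable A -> mu A <= nu A) -> measurable A ->
  (mu \x mu) A <= (nu \x nu) A.
Proof.
move=> munu mA; rewrite /product_measure1.
apply: (@le_trans _ _ (\int[mu]_x (nu \o xsection A) x)).
  apply: ge0_le_integral => //; [exact: measurable_fun_xsection..|].
  by move=> x _; exact/munu/measurable_xsection.
by apply: ge0_le_measure_integral => //; exact: measurable_fun_xsection.
Qed.

End product_pushforward.

Lemma Lnorm_product_le_cst d (T : measurableType d) (R : realType)
    (mu : {finite_measure set T -> \bar R}) (f : T * T -> \bar R) p (c : R) N :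
  measurable_fun setT f -> 1 <= p -> mu setT <= 1 -> (0 <= c)%R ->
  measurable N -> mu N = 0 ->
  (forall x y, ~ N x -> ~ N y -> `|f (x, y)| <= c%:E) ->
  'N[mu \x mu]_p[f] <= c%:E.
Proof.
move=> mf p1 muT c0 mN muN fc; apply: Lnorm_le_cst => //.
  rewrite -setXTT [leLHS]product_measure1E// -[leRHS]mule1.
  exact: lee_pmul.
(* The bound can fail only if one coordinate lies in [N], and both strips are null for the
   product. *)
exists ((N `*` setT) `|` (setT `*` N)); split.
- by apply: measurableU; exact: measurableX.
- apply/eqP; rewrite -measure_le0.
  apply: le_trans (measureU2 _ _ _) _; [exact: measurableX..|].
  by rewrite [X in X + _]product_measure1E// [X in _ + X]product_measure1E//
    /= muN mule0 mul0e adde0.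
move=> [x y] /=; apply: contra_notP => /not_orP[Nx Ny].
by apply: fc => ?; [apply: Nx|apply: Ny]; split.
Qed.

(** * Approximate gluing along a countable partition *)

Section glue.
Context d1 d2 d3 (T1 : measurableType d1) (T2 : measurableType d2)
  (T3 : measurableType d3) (R : realType).
Variables (pi12 : {finite_measure set (T1 * T2)%type -> \bar R})
  (pi23 : {finite_measure set (T2 * T3)%type -> \bar R})
  (mu : {finite_measure set T2 -> \bar R}) (A : (set T2)^nat).
Hypotheses (mA : forall n, measurable (A n)) (tA : trivIset setT A)
  (UA : \bigcup_n A n = setT).

Let W := ((T1 * T2) * (T2 * T3))%type.
Let a n := pi12 (setT `*` A n).
Let b n := pi23 (A n `*` setT).
Let B n : set W := (setT `*` A n) `*` (A n `*` setT).

Let mB n : measurable (B n).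
Proof. by apply: measurableX; exact: measurableX. Qed.

Let a_fin n : a n \is a fin_num.
Proof. by apply: fin_num_measure; exact: measurableX. Qed.
Let b_fin n : b n \is a fin_num.
Proof. by apply: fin_num_measure; exact: measurableX. Qed.

(** The normalising constant of cell [n]: dividing by the larger mass keeps both projections below
    [pi12] and [pi23]. If both masses are 0, the inverse is 0 by convention and the cell contributes
    nothing. *)
Let M n : R := Num.max (fine (a n)) (fine (b n)).

Let M_ge0 n : (0 <= (M n)^-1)%R.
Proof. by rewrite invr_ge0 le_max fine_ge0. Qed.

Let c n : {nonneg R} := NngNum (M_ge0 n).

Let g := mseries (fun n => mscale (c n) (mrestr (pi12 \x pi23) (mB n))) 0.

HB.instance Definition _ := Measure.on g.

Let ca_le1 n : (c n)%:num%:E * a n <= 1.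
Proof.
rewrite -(fineK (a_fin n)) -EFinM lee_fin /=.
have [->|M0] := eqVneq (M n) 0%R; first by rewrite invr0 mul0r.
rewrite mulrC ler_pdivrMr ?mul1r ?le_max ?lexx//.
by rewrite lt_neqAle eq_sym M0 le_max fine_ge0.
Qed.

Let cb_le1 n : (c n)%:num%:E * b n <= 1.
Proof.
rewrite -(fineK (b_fin n)) -EFinM lee_fin /=.
have [->|M0] := eqVneq (M n) 0%R; first by rewrite invr0 mul0r.
rewrite mulrC ler_pdivrMr ?mul1r ?le_max ?lexx ?orbT//.
by rewrite lt_neqAle eq_sym M0 le_max fine_ge0.
Qed.

(** The product of two numbers is the product of their maximum and minimum; when the maximum is 0,
    so is the minimum. *)
Let cab n : (c n)%:num%:E * (a n * b n) = mine (a n) (b n).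
Proof.
rewrite -(fineK (a_fin n)) -(fineK (b_fin n)) -!EFinM -EFin_min; congr EFin => /=.
have a0 : (0 <= fine (a n))%R by exact: fine_ge0.
have b0 : (0 <= fine (b n))%R by exact: fine_ge0.
rewrite /M; case: (leP (fine (a n)) (fine (b n))) => ab.
- have [b00|bn0] := eqVneq (fine (b n)) 0%R; last by rewrite mulrC mulfK.
  by rewrite b00 !mulr0; apply/eqP; rewrite eq_le a0 -b00 ab.
- have [a00|an0] := eqVneq (fine (a n)) 0%R; last by rewrite mulKf.
  by move: ab; rewrite a00 ltNge b0.
Qed.

Let gE E : g E = \sum_(n <oo) (c n)%:num%:E * (pi12 \x pi23) (E `&` B n).
Proof. by []. Qed.

(** Inside cell [n] the measure [g] is a product, so integrating out the second factor leaves [pi12]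
    times [c n * b n], which is at most 1; the cells then sum back to [pi12 E]. *)
Let g_fst E : measurable E -> g (E `*` setT) <= pi12 E.
Proof.
move=> mE; have mEA n : measurable (E `&` (setT `*` A n)).
  by apply: measurableI => //; exact: measurableX.
rewrite gE.
have -> : pi12 E = \sum_(n <oo) pi12 (E `&` (setT `*` A n)).
  rewrite -measure_semi_bigcup//.
  - by rewrite -setI_bigcupr -setX_bigcupr UA setXTT setIT.
  - apply: trivIset_setIl; apply/trivIsetP => i j _ _ ij.
    by rewrite -setXI; move/trivIsetP : tA => -> //; rewrite setX0.
  - exact: bigcup_measurable.
apply: lee_nneseries => [n _ _|n _]; first by rewrite mule_ge0.
rewrite /B -setXI setTI product_measure1E//; last exact: measurableX.
rewrite muleCA -[leRHS]mule1; apply: lee_wpmul2l => //; exact: cb_le1.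
Qed.

Let g_snd E : measurable E -> g (setT `*` E) <= pi23 E.
Proof.
move=> mE; have mEA n : measurable (E `&` (A n `*` setT)).
  by apply: measurableI => //; exact: measurableX.
rewrite gE.
have -> : pi23 E = \sum_(n <oo) pi23 (E `&` (A n `*` setT)).
  rewrite -measure_semi_bigcup//.
  - by rewrite -setI_bigcupr -setX_bigcupl UA setXTT setIT.
  - apply: trivIset_setIl; apply/trivIsetP => i j _ _ ij.
    by rewrite -setXI; move/trivIsetP : tA => -> //; rewrite set0X.
  - exact: bigcup_measurable.
apply: lee_nneseries => [n _ _|n _]; first by rewrite mule_ge0.
rewrite /B -setXI setTI product_measure1E//; last exact: measurableX.
rewrite muleA -[leRHS]mul1e; apply: lee_wpmul2r => //; exact: ca_le1.
Qed.

Let gT : g setT = \sum_(n <oo) mine (a n) (b n).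
Proof.
rewrite gE; apply: eq_eseriesr => n _.
by rewrite setTI product_measure1E ?cab//; exact: measurableX.
Qed.

Let g_offdiag : g (~` \bigcup_n (B n)) = 0.
Proof.
rewrite gE eseries0// => n _ _.
suff -> : ~` (\bigcup_n B n) `&` B n = set0 by rewrite measure0 mule0.
by apply/seteqP; split => // x [+ Bx]; apply; exists n.
Qed.

Let g_fin : fin_num_fun g.
Proof.
move=> E mE; rewrite ge0_fin_numE//.
apply: (@le_lt_trans _ _ (g (setT `*` setT))).
  by apply: le_measure; rewrite ?inE// setXTT.
apply: le_lt_trans (g_fst measurableT) _.
by rewrite ltey_eq fin_num_measure.
Qed.

HB.instance Definition _ := Measure_isFinite.Build _ _ _ g g_fin.

Hypotheses (pi12_mu : forall E, measurable E -> pi12 (setT `*` E) <= mu E)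
  (pi23_mu : forall E, measurable E -> pi23 (E `*` setT) <= mu E).

(** Cell by cell, [a n + b n] is minimum plus maximum, and the two marginal bounds put the maximum
    below [mu (A n)]. *)
Let gT_ge : pi12 setT + pi23 setT <= g setT + mu setT.
Proof.
have -> : pi12 setT = \sum_(n <oo) a n.
  rewrite /a -measure_semi_bigcup//.
  - by rewrite -setX_bigcupr UA setXTT.
  - by move=> n; exact: measurableX.
  - apply/trivIsetP => i j _ _ ij.
    by rewrite -setXI; move/trivIsetP : tA => -> //; rewrite setX0.
  - by apply: bigcup_measurable => n _; exact: measurableX.
have -> : pi23 setT = \sum_(n <oo) b n.
  rewrite /b -measure_semi_bigcup//.
  - by rewrite -setX_bigcupl UA setXTT.
  - by move=> n; exact: measurableX.
  - apply/trivIsetP => i j _ _ ij.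
    by rewrite -setXI; move/trivIsetP : tA => -> //; rewrite set0X.
  - by apply: bigcup_measurable => n _; exact: measurableX.
have -> : mu setT = \sum_(n <oo) mu (A n).
  rewrite -measure_semi_bigcup// ?UA//; exact: bigcup_measurable.
have min0 n : 0 <= mine (a n) (b n) by rewrite le_min !measure_ge0.
rewrite gT -!nneseriesD//.
apply: lee_nneseries => [n _ _|n _]; first by rewrite adde_ge0 ?measure_ge0.
have := pi12_mu (mA n); have := pi23_mu (mA n); rewrite -/(a n) -/(b n).
case: (leP (a n) (b n)) => _ ? ?; first by rewrite leeD.
by rewrite addeC leeD.
Qed.

(** Domination of the projections suffices: partial couplings only bound marginals from above, and
    [dis_norm] is monotone in the measure. The null set in the last clause replaces equality of the
    two middle coordinates by membership in a common cell. *)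
Lemma approximate_gluing (m : R) : (0 <= m)%R ->
  mu setT + m%:E <= pi12 setT + pi23 setT ->
  exists gamma : {finite_measure set ((T1 * T2) * (T2 * T3))%type -> \bar R},
  [/\ forall E, measurable E -> gamma (E `*` setT) <= pi12 E,
      forall E, measurable E -> gamma (setT `*` E) <= pi23 E,
      gamma setT = m%:E &
      gamma (~` \bigcup_n ((setT `*` A n) `*` (A n `*` setT))) = 0].
Proof.
move=> m0 mass.
have gTfin : g setT \is a fin_num by exact: g_fin.
have mle : (m <= fine (g setT))%R.
  rewrite -lee_fin fineK// -(leeD2rE (x := mu setT)) ?fin_num_measure//.
  by rewrite addeC (le_trans mass).
(* Shrinking by a factor at most 1 preserves both dominations. If [g] has mass 0, then [m] is 0 as
   well and division by 0 gives the factor 0. *)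
have t0 : (0 <= m / fine (g setT))%R by rewrite divr_ge0// fine_ge0.
have t1 : (m / fine (g setT) <= 1)%R.
  have [->|gn0] := eqVneq (fine (g setT)) 0%R; first by rewrite invr0 mulr0.
  by rewrite ler_pdivrMr ?mul1r// lt_neqAle eq_sym gn0 fine_ge0.
have scale_le E : mscale (NngNum t0) g E <= g E.
  by rewrite /mscale/= -[leRHS]mul1e; apply: lee_wpmul2r; rewrite ?lee_fin.
exists (mscale (NngNum t0) g); split.
- by move=> E mE; apply: le_trans (scale_le _) (g_fst mE).
- by move=> E mE; apply: le_trans (scale_le _) (g_snd mE).
- rewrite /= /mscale/= -(fineK gTfin) -EFinM; congr EFin.
  have [g0|gn0] := eqVneq (fine (g setT)) 0%R; last by rewrite divfK.
  by rewrite g0 mulr0; apply/eqP; rewrite eq_le m0 -g0 mle.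
- by rewrite /= /mscale [X in _ * X]g_offdiag mule0.
Qed.

End glue.

(** * Borel structure of a complete separable metric space *)

Section metric_borel.
Context (R : realType) (T : pointedType) (d : T -> T -> R).
Hypothesis dT : polish_metric d.
Local Open Scope ring_scope.

Lemma dball_measurable (x : T) (r : R) :
  measurable (dball d x r : set (borel_of d)).
Proof.
have [[_ _ _ tri] _ _] := dT.
apply: sub_sigma_algebra => y xy; exists (r - d x y); first by rewrite subr_gt0.
move=> z yz; rewrite /dball/= (le_lt_trans (tri x y z))//.
by rewrite -ltrBrDl.
Qed.

Lemma dense_sequence : exists q : nat -> T,
  forall x e, 0 < e -> exists n, d x (q n) < e.
Proof.
have [_ _ [D [cD densD]]] := dT.
have /pcard_surjP[q qD] := cD; exists q => x e /(densD x)[y Dy xy].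
by have [n _ qn] := qD _ Dy; exists n; rewrite qn.
Qed.

(** Measurability is for the product of the Borel sigma-algebras, so separability enters:
    [d x y < r] exactly when some [q n] gives a detour [d (q n) x + d (q n) y < r]. *)
Lemma measurable_dist :
  measurable_fun setT (fun z : borel_of d * borel_of d => d z.1 z.2).
Proof.
have [[_ _ sym tri] _ _] := dT.
have [q densq] := dense_sequence.
have mdq (x : T) : measurable_fun setT (fun y : borel_of d => d x y).
  apply: (measurability _ (RGenInftyO.measurableE R)) => _ [_ [r ->] <-].
  rewrite setTI (_ : _ @^-1` _ = dball d x r); first exact: dball_measurable.
  by apply/seteqP; split => y; rewrite /dball/= in_itv.
apply: (measurability _ (RGenInftyO.measurableE R)) => _ [_ [r ->] <-].
rewrite setTI (_ : _ @^-1` _ = \bigcup_n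
    ((fun z : borel_of d * borel_of d => d (q n) z.1 + d (q n) z.2) @^-1`
      [set` `]-oo, r[])).
  apply: bigcupT_measurable => n; rewrite -[X in measurable X]setTI.
  suff : measurable_fun setT
      (fun z : borel_of d * borel_of d => d (q n) z.1 + d (q n) z.2).
    by apply => //; exact: measurable_itv.
  by apply: measurable_funD; apply: (measurableT_comp (mdq (q n))).
apply/seteqP; split => [[x y]|[x y] [n _]]; rewrite /= !in_itv/=; last first.
  by apply: le_lt_trans; rewrite (sym (q n) x); exact: tri.
(* A detour through a point within half of the slack [r - d x y] from [x] lengthens the path by less
   than that slack. *)
move=> xyr; have [|n xqn] := densq x ((r - d x y) / 2).
  by rewrite divr_gt0// subr_gt0.
exists n => //=; rewrite in_itv/=.
have := tri (q n) x y; rewrite (sym (q n) x); lra.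
Qed.

(** Balls of radius [e / 2] around a dense sequence cover the space; removing the earlier balls from
    each makes them disjoint without increasing diameters. *)
Lemma small_partition (e : R) : 0 < e -> exists A : (set (borel_of d))^nat,
  [/\ forall n, measurable (A n), trivIset setT A, \bigcup_n A n = setT &
      forall n x y, A n x -> A n y -> d x y <= e].
Proof.
move=> e0; have [[_ _ sym tri] _ _] := dT; have [q densq] := dense_sequence.
exists (seqDU (fun n => dball d (q n) (e / 2))); split => //.
- apply: seqDU_measurable => n; exact: dball_measurable.
- rewrite -seqDU_bigcup_eq; apply/seteqP; split => // x _.
  by have [|n xqn] := densq x (e / 2); [rewrite divr_gt0|exists n => //;
    rewrite /dball/= sym].
- move=> n x y Ax Ay; have qx := subset_seqDU Ax; have qy := subset_seqDU Ay.
  move: qx qy; rewrite /dball/= => qx qy.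
  have := tri x (q n) y; rewrite (sym x (q n)); lra.
Qed.

End metric_borel.


(** * Distortion along pushforwards and under domination *)

Lemma measurable_dist_gap (R : realType) (TX TY : pointedType)
    (dX : TX -> TX -> R) (dY : TY -> TY -> R) :
  polish_metric dX -> polish_metric dY ->
  measurable_fun setT (@dist_gap R TX TY dX dY).
Proof.
move=> hX hY; apply/measurable_EFinP; apply: measurable_funB.
- apply: (measurableT_comp (measurable_dist hX) (g := fun z => (z.1.1, z.2.1))).
  by apply: measurable_fun_pair; do 2!apply: measurableT_comp => //.
- apply: (measurableT_comp (measurable_dist hY) (g := fun z => (z.1.2, z.2.2))).
  by apply: measurable_fun_pair; do 2!apply: measurableT_comp => //.
Qed.

(** Moves the distortion of every projection of a glued measure to one common space, where
    Minkowski's inequality applies. *)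
Lemma dis_norm_pushforward (R : realType) (TX TY : pointedType)
    (dX : TX -> TX -> R) (dY : TY -> TY -> R) (p : \bar R)
    (d : measure_display) (W : measurableType d)
    (gamma : {finite_measure set W -> \bar R})
    (phi : W -> (borel_of dX * borel_of dY)%type) (mphi : measurable_fun setT phi) :
  polish_metric dX -> polish_metric dY -> 1 <= p ->
  @dis_norm R TX TY dX dY p (finite_pushforward gamma mphi) =
  'N[gamma \x gamma]_p[(fun z => @dist_gap R TX TY dX dY (phi z.1, phi z.2))].
Proof.
move=> hX hY p1; apply: (@Lnorm_pushforward _ _ _ _ _ _ _
  (fun z => (phi z.1, phi z.2))) => //.
- exact: measurable_map_pair.
- exact: measurable_dist_gap.
- by move=> A mA; exact: product_pushforward.
Qed.

Lemma le_dis_norm (R : realType) (TX TY : pointedType)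
    (dX : TX -> TX -> R) (dY : TY -> TY -> R) (p : \bar R)
    (pi1 pi2 : {finite_measure set (borel_of dX * borel_of dY)%type -> \bar R}) :
  polish_metric dX -> polish_metric dY -> 1 <= p ->
  (forall A, measurable A -> pi1 A <= pi2 A) ->
  dis_norm p pi1 <= dis_norm p pi2.
Proof.
move=> hX hY p1 pi12; apply: le_Lnorm_measure => //.
  exact: measurable_dist_gap.
by move=> A mA; exact: le_product_measure.
Qed.

(** * The triangle inequality at fixed masses *)

Section triangle.
Context (R : realType) (TX TY TZ : pointedType).
Variables (dX : TX -> TX -> R) (dY : TY -> TY -> R) (dZ : TZ -> TZ -> R).
Hypotheses (hX : polish_metric dX) (hY : polish_metric dY) (hZ : polish_metric dZ).
Variables (muX : probability (borel_of dX) R) (muY : probability (borel_of dY) R)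
  (muZ : probability (borel_of dZ) R).
Variable p : \bar R.
Hypothesis p1 : 1 <= p.

Lemma mPGW_le_dis_normD (s t e : R)
    (pi12 : {finite_measure set (borel_of dX * borel_of dY)%type -> \bar R})
    (pi23 : {finite_measure set (borel_of dY * borel_of dZ)%type -> \bar R}) :
  (0 <= s)%R -> (0 <= t)%R -> (s + t <= 1)%R -> (0 < e)%R ->
  partial_coupling muX muY (1 - s) pi12 -> partial_coupling muY muZ (1 - t) pi23 ->
  mPGW muX muZ (1 - (s + t)) p <= dis_norm p pi12 + (e%:E + dis_norm p pi23).
Proof.
move=> s0 t0 st1 e0 [piX piY pi12T] [piY' piZ pi23T].
(* The middle gap compares two points of the glued space; each has its two Y-coordinates within
   [e / 2], for a total of at most [e]. *)
have [|A [mA tA UA dA]] := @small_partition _ _ _ hY (e / 2).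
  by rewrite divr_gt0.
have m0 : (0 <= 1 - (s + t))%R by rewrite subr_ge0.
(* Equality holds here: both sides are [2 - (s + t)]. *)
have mass : muY setT + (1 - (s + t))%:E <= pi12 setT + pi23 setT.
  by rewrite probability_setT pi12T pi23T -!EFinD lee_fin; lra.
have [gamma [gfst gsnd gT goff]] :=
    approximate_gluing mA tA UA piY piY' m0 mass.
have mphi : measurable_fun setT
    (fun w : (borel_of dX * borel_of dY) * (borel_of dY * borel_of dZ) =>
      (w.1.1, w.2.2)).
  by apply: measurable_fun_pair; apply: measurableT_comp.
have mfst := @measurable_fst _ _ (borel_of dX * borel_of dY)%type
  (borel_of dY * borel_of dZ)%type.
have msnd := @measurable_snd _ _ (borel_of dX * borel_of dY)%type
  (borel_of dY * borel_of dZ)%type.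
(* The (X, Z)-projection of [gamma] competes in the infimum; its marginals are bounded through those
   of [pi12] and [pi23]. *)
apply: (@le_trans _ _ (dis_norm p (finite_pushforward gamma mphi))).
  apply: ereal_inf_lbound; exists (finite_pushforward gamma mphi) => //; split.
  - move=> E mE; apply: le_trans (piX _ mE).
    rewrite [leLHS](_ : _ = gamma ((E `*` setT) `*` setT)).
      by apply: gfst; exact: measurableX.
    by congr (gamma _); apply/seteqP; split => [[[x y] [y' z]]|[[x y] [y' z]]] /= [].
  - move=> E mE; apply: le_trans (piZ _ mE).
    rewrite [leLHS](_ : _ = gamma (setT `*` (setT `*` E))).
      by apply: gsnd; exact: measurableX.
    by congr (gamma _); apply/seteqP; split => [[[x y] [y' z]]|[[x y] [y' z]]] /= [].
  - by rewrite /= /finite_pushforward /pushforward preimage_setT gT.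
(* The (X, Y)-projection of [gamma] is dominated by [pi12], so monotonicity of the distortion gives
   the bound. *)
have le12 : 'N[gamma \x gamma]_p[(fun z => @dist_gap R TX TY dX dY (z.1.1, z.2.1))]
    <= dis_norm p pi12.
  rewrite -(dis_norm_pushforward gamma mfst hX hY p1); apply: le_dis_norm => // E mE.
  by rewrite [leLHS](_ : _ = gamma (E `*` setT)) ?gfst//= setXT.
have le23 : 'N[gamma \x gamma]_p[(fun z => @dist_gap R TY TZ dY dZ (z.1.2, z.2.2))]
    <= dis_norm p pi23.
  rewrite -(dis_norm_pushforward gamma msnd hY hZ p1); apply: le_dis_norm => // E mE.
  by rewrite [leLHS](_ : _ = gamma (setT `*` E)) ?gsnd//= setTX.
rewrite dis_norm_pushforward//.
pose W := ((borel_of dX * borel_of dY) * (borel_of dY * borel_of dZ))%type.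
(* Telescoping of the (X, Z)-gap: [f1] and [f3] are the gaps controlled by [pi12] and [pi23], and
   [f2] compares the two copies of Y. *)
pose f1 (z : W * W) : R := (dX z.1.1.1 z.2.1.1 - dY z.1.1.2 z.2.1.2)%R.
pose f2 (z : W * W) : R := (dY z.1.1.2 z.2.1.2 - dY z.1.2.1 z.2.2.1)%R.
pose f3 (z : W * W) : R := (dY z.1.2.1 z.2.2.1 - dZ z.1.2.2 z.2.2.2)%R.
have mf1 : measurable_fun setT f1.
  apply/measurable_EFinP.
  exact: measurableT_comp (measurable_dist_gap hX hY) (measurable_map_pair mfst).
have mf3 : measurable_fun setT f3.
  apply/measurable_EFinP.
  exact: measurableT_comp (measurable_dist_gap hY hZ) (measurable_map_pair msnd).
have mf2 : measurable_fun setT f2.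
  have myy : measurable_fun setT (fun w : W => (w.1.2, w.2.1)).
    by apply: measurable_fun_pair; exact: measurableT_comp.
  apply/measurable_EFinP.
  exact: measurableT_comp (measurable_dist_gap hY hY) (measurable_map_pair myy).
have -> : (fun z : W * W => @dist_gap R TX TZ dX dZ
    ((z.1.1.1, z.1.2.2), (z.2.1.1, z.2.2.2))) = EFin \o (f1 \+ (f2 \+ f3))%R.
  by apply/funext => z; rewrite /dist_gap/= /f1 /f2 /f3; congr EFin; ring.
apply: le_trans (eminkowski _ mf1 _ p1) _; first exact: measurable_funD.
apply: leeD; first exact: le12.
apply: le_trans (eminkowski _ mf2 mf3 p1) _.
apply: leeD; last exact: le23.
pose N : set W := ~` \bigcup_n ((setT `*` A n) `*` (A n `*` setT)).
have mN : measurable N.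
  apply: measurableC; apply: bigcup_measurable => n _.
  by apply: measurableX; exact: measurableX.
apply: (Lnorm_product_le_cst _ p1 _ (ltW e0) mN goff) => //.
- exact/measurable_EFinP.
- by rewrite gT lee_fin; lra.
move=> w w' wN w'N.
(* The points [w] and [w'] may lie in different cells [n] and [k]; what counts is that each has its
   own two Y-coordinates close. Four triangle inequalities then bound both signs of [f2]. *)
move: wN w'N => /contrapT[n _ /= [[_ An1] [An2 _]]] /contrapT[k _ /= [[_ Ak1] [Ak2 _]]].
have [[_ _ sym tri] _ _] := hY.
rewrite lee_fin /f2/=.
have := dA _ _ _ An1 An2; have := dA _ _ _ Ak1 Ak2.
have := tri w.1.2 w.2.1 w'.1.2; have := tri w.2.1 w'.2.1 w'.1.2.
have := tri w.2.1 w.1.2 w'.2.1; have := tri w.1.2 w'.1.2 w'.2.1.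
rewrite (sym w.2.1 w.1.2) (sym w'.2.1 w'.1.2) ler_norml; lra.
Qed.

End triangle.

(** * Passage to the infimum over delta *)

(** The zero measure is a partial coupling of mass 0. This makes [delta = 1] admissible in [mPGWk]
    for every slope [k >= 0]. *)
Lemma mPGW0_le0 (R : realType) (TX TY : pointedType)
    (dX : TX -> TX -> R) (dY : TY -> TY -> R)
    (muX : probability (borel_of dX) R) (muY : probability (borel_of dY) R)
    (p : \bar R) : polish_metric dX -> polish_metric dY -> 1 <= p ->
  mPGW muX muY 0 p <= 0.
Proof.
move=> hX hY p1.
have zfin : fin_num_fun (@mzero _ (borel_of dX * borel_of dY)%type R) by [].
pose z : {finite_measure set (borel_of dX * borel_of dY)%type -> \bar R} :=
  HB.pack (@mzero _ (borel_of dX * borel_of dY)%type R)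
    (Measure_isFinite.Build _ _ _ (@mzero _ (borel_of dX * borel_of dY)%type R) zfin).
apply: (@le_trans _ _ (dis_norm p z)).
  by apply: ereal_inf_lbound; exists z => //; split => //= A mA; rewrite /mzero.
(* The whole space is null for the zero measure, so with [N = setT] the pointwise bound is
   vacuous. *)
apply: (Lnorm_product_le_cst _ p1 _ (lexx 0%R) measurableT) => //.
- exact: measurable_dist_gap.
- exact: lee01.
- by move=> x y /(_ I).
Qed.

(** The bound [a] and nonnegativity of norms make the infimum finite, so near-minimisers exist. *)
Lemma mPGW_approx (R : realType) (TX TY : pointedType)
    (dX : TX -> TX -> R) (dY : TY -> TY -> R)
    (muX : probability (borel_of dX) R) (muY : probability (borel_of dY) R)
    (p : \bar R) (m a e : R) :
  mPGW muX muY m p <= a%:E -> (0 < e)%R ->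
  exists2 pi, partial_coupling muX muY m pi & dis_norm p pi <= (a + e)%:E.
Proof.
move=> ma e0.
have mfin : mPGW muX muY m p \is a fin_num.
  rewrite ge0_fin_numE ?(le_lt_trans ma) ?ltry//.
  by apply: le_ereal_inf_tmp => _ [pi _ <-]; exact: Lnorm_ge0.
have [_ [pi ppi <-] pilt] := lb_ereal_inf_adherent e0 mfin.
by exists pi => //; rewrite EFinD (le_trans (ltW pilt))// leeD2r.
Qed.

Lemma mPGWk_ge0 (R : realType) (TX TY : pointedType)
    (dX : TX -> TX -> R) (dY : TY -> TY -> R)
    (muX : probability (borel_of dX) R) (muY : probability (borel_of dY) R)
    (k : R) (p : \bar R) : 0 <= mPGWk muX muY k p.
Proof. by apply: le_ereal_inf_tmp => _ [s [/andP[s0 _] _] <-]; rewrite lee_fin. Qed.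

Lemma mPGWk_leD (R : realType) (p : \bar R) (k : R)
    (TX TY TZ : pointedType)
    (dX : TX -> TX -> R) (dY : TY -> TY -> R) (dZ : TZ -> TZ -> R)
    (muX : probability (borel_of dX) R) (muY : probability (borel_of dY) R)
    (muZ : probability (borel_of dZ) R) (s t : R) :
  polish_metric dX -> polish_metric dY -> polish_metric dZ ->
  1 <= p -> (0 <= k)%R -> (0 <= s)%R -> (0 <= t)%R ->
  mPGW muX muY (1 - s) p <= (k * s)%:E ->
  mPGW muY muZ (1 - t) p <= (k * t)%:E ->
  mPGWk muX muZ k p <= (s + t)%:E.
Proof.
move=> hX hY hZ p1 k0 s0 t0 hs ht.
(* Once [s + t] reaches 1, the admissible value [delta = 1] already gives the bound. *)
have [st1|st1] := leP 1%R (s + t)%R.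
  apply: (@le_trans _ _ 1%:E); last by rewrite lee_fin.
  apply: ereal_inf_lbound; exists 1%R => //; split; first by rewrite ler01 lexx.
  by rewrite subrr mulr1 (le_trans (mPGW0_le0 _ _ hX hZ p1))// lee_fin.
apply: ereal_inf_lbound; exists (s + t)%R => //; split.
  by rewrite addr_ge0//= ltW.
(* Admissibility of [s + t] asks for the exact bound [k * (s + t)], so the slack [e] is arbitrary:
   one third for each near-optimal coupling and one for the gluing. *)
apply/lee_addgt0Pr => e e0; have e30 : (0 < e / 3)%R by rewrite divr_gt0.
have [pi12 pc12 le12] := mPGW_approx hs e30.
have [pi23 pc23 le23] := mPGW_approx ht e30.
apply: le_trans (mPGW_le_dis_normD hX hY hZ p1 s0 t0 (ltW st1) e30 pc12 pc23) _.
apply: (@le_trans _ _ ((k * s + e / 3)%:E + ((e / 3)%:E + (k * t + e / 3)%:E))).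
  by apply: leeD => //; rewrite leeD2l.
by rewrite -!EFinD lee_fin; lra.
Qed.
Local Close Scope ereal_scope.

Theorem theorem4p4 (R : realType) (p : \bar R) (k : R)
  (TX TY TZ : pointedType)
  (dX : TX -> TX -> R) (dY : TY -> TY -> R) (dZ : TZ -> TZ -> R)
  (hX : polish_metric dX) (hY : polish_metric dY) (hZ : polish_metric dZ)
  (muX : probability (borel_of dX) R) (muY : probability (borel_of dY) R)
  (muZ : probability (borel_of dZ) R) :
  (1 <= p)%E -> 0 <= k ->
  (@mPGWk R TX TZ dX dZ muX muZ k p <=
   @mPGWk R TX TY dX dY muX muY k p + @mPGWk R TY TZ dY dZ muY muZ k p)%E.
Proof.
move=> p1 k0.
(* Infinite values are set apart because the extraction of near-minimal [s] and [t] below works with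
   finite infima. *)
have [fin12|] := boolP (mPGWk muX muY k p \is a fin_num); last first.
  rewrite ge0_fin_numE ?mPGWk_ge0// -leNgt leye_eq => /eqP ->.
  by rewrite addye ?leey// -ltNye (lt_le_trans ltNy0) ?mPGWk_ge0.
have [fin23|] := boolP (mPGWk muY muZ k p \is a fin_num); last first.
  rewrite ge0_fin_numE ?mPGWk_ge0// -leNgt leye_eq => /eqP ->.
  by rewrite addey ?leey// -ltNye (lt_le_trans ltNy0) ?mPGWk_ge0.
apply/lee_addgt0Pr => e e0; have e20 : 0 < e / 2 by rewrite divr_gt0.
have [_ [s [/andP[s0 _] hs] <-] slt] := lb_ereal_inf_adherent e20 fin12.
have [_ [t [/andP[t0 _] ht] <-] tlt] := lb_ereal_inf_adherent e20 fin23.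
apply: le_trans (mPGWk_leD hX hY hZ p1 k0 s0 t0 hs ht) _.
rewrite EFinD (le_trans (leeD (ltW slt) (ltW tlt)))//.
by rewrite addeACA -EFinD -splitr.
Qed.
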